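(* If $\mathbb{E}S_N<0$, then the distribution functions $F_\infty^{(1)},\ldots,F_\infty^{(N)}$ satisfy $$F_\infty^{(j)}(n)=\sum_{r=1}^{N}\ \sum_{\ell=m_r}^{-1}a_{n-\ell}^{I_{jr}}\sum_{i=0}^{\ell-m_r}\pi_i^{(r+1)}F_{X_r}(\ell-i),\qquad j=1,2,\ldots,N,\quad n\in\mathbb N_0,$$ where $$I_{jr}:=\begin{cases}(j,j+1,\ldots,r-1), & j<r,\\ \varnothing, & j=r,\\ (1,\ldots,r-1,j,j+1,\ldots,N), & j>r,\end{cases}\qquad \mu_{jr}:=\sum_{t\in I_{jr}}m_t,$$ $$a_n^{I_{jr}}=\begin{cases}\displaystyle\sum_{k=\mu_{jr}}^{n+D}p_k^{I_{jr}}\,a_{n-k}, & n\ge\mu_{jr}-D,\\ 0, & n<\mu_{jr}-D,\end{cases}\qquad p_k^{I_{jr}}=\mathbb P\Big(\sum_{t\in I_{jr}}X_t=k\Big),\ k\in\mathbb Z,$$ with the convention that if $I_{jr}=\varnothing$ then $a_n^{\varnothing}=a_n$ (for $n\ge -D$, and $a_n^{\varnothing}=0$ for $n<-D$), $\mu_{jr}=0$, $p_0^{\varnothing}=1$ and $p_k^{\varnothing}=0$ for $k\ne0$, and where $$a_{-D}=\frac1{f_N(D)},\qquad a_n=\frac1{f_N(D)}\Big(\mathbf 1_{\{n\ge-2D\}}\,a_{n+D}-\sum_{k=1}^{n+D}f_N(k+D)\,a_{n-k}\Big),\quad n\ge-D+1,$$ and $\pi^{(N+1)}=\pi^{(1)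}$.
   Context: Let $N\in\mathbb N$ and let $X_1,X_2,\ldots$ be independent integer-valued random variables that are $N$-periodic in distribution: $X_k$ and $X_{k+N}$ have the same distribution for all $k\in\mathbb N$. For $j=1,\ldots,N$ the support of $X_j$ starts at $m_j\in\mathbb Z$, i.e. $\mathbb P(X_j=m_j)>0$ and $\mathbb P(X_j\ge m_j)=1$, and $D:=m_1+\cdots+m_N<0$ (the individual $m_j$ may have any sign). Put $S_N:=X_1+\cdots+X_N$, $f_N(k):=\mathbb P(S_N=k)$ and $F_{X_j}(k):=\mathbb P(X_j\le k)$. For $j=1,\ldots,N$ define $$F_\infty^{(j)}(x):=\mathbb P\Big(\sup_{n\ge j}\sum_{k=j}^nX_k\le x\Big),\quad x\in\mathbb Z,$$ and $\mathcal M_j:=\max\{0,\,X_j,\,X_j+X_{j+1},\,X_j+X_{j+1}+X_{j+2},\ldots\}$ (supremum over all partial sums started at index $j$), $\pi^{(j)}_k:=\mathbb P(\mathcal M_j=k)$ for $k\in\mathbb N_0=\{0,1,2,\ldots\}$. Empty sums are $0$ (in particular the sum over $\ell$ from $m_r$ to $-1$ is $0$ when $m_r\ge0$). $\mathbf 1_{\{\cdot\}}$ denotes the indicator. For $r=1$ the initial part $1,\ldots,r-1$ of $I_{jr}$ is absent. *)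

(* Defs.v *)
From HB Require Import structures.
From mathcomp Require Import all_boot all_order all_algebra.
From mathcomp Require Import all_classical all_reals all_analysis.
From mathcomp Require Import measurable_realfun.
From mathcomp Require Import zify.

Set Implicit Arguments.
Unset Strict Implicit.
Unset Printing Implicit Defensive.

Import Order.TTheory GRing.Theory Num.Theory.

Local Open Scope classical_set_scope.
Local Open Scope ring_scope.

(* \sum_(k = a)^b F k over the integers; empty when b < a. *)
Definition sumz (V : nmodType) (a b : int) (F : int -> V) : V :=
  if a <= b then \sum_(0 <= i < (absz (b - a)%R).+1) F (a + i%:Z) else 0.

Section RandomWalk.
Context {d : measure_display} {T : measurableType d} {R : realType}.
Variable P : probability T R.
Implicit Types (X : nat -> {RV P >-> R}) (s : seq nat).

Definition mutually_independent (K : set nat) X : Prop :=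
  forall s, uniq s -> (forall k, k \in s -> K k) ->
  forall B : nat -> set R, (forall k, measurable (B k)) ->
    P (\bigcap_(k in [set` s]) (X k @^-1` B k)) =
    (\prod_(k <- s) P (X k @^-1` B k))%E.

Definition rv_sum X s : {RV P >-> R} := \sum_(t <- s) (X t : {mfun T >-> R}).

Lemma rv_sumE X s w : rv_sum X s w = \sum_(t <- s) X t w.
Proof. exact: mfun_sum. Qed.

(* sup_(n >= j) (X_j + ... + X_n); it may take the value +oo. *)
Definition sup_walk X (j : nat) (w : T) : \bar R :=
  ereal_sup [set (rv_sum X (index_iota j n.+1) w)%:E | n in [set n | (j <= n)%N]].

Definition F_infty X (j : nat) (x : int) : R :=
  fine (P [set w | (sup_walk X j w <= (x%:~R)%:E)%E]).

Definition walk_max X (j : nat) (w : T) : \bar R := maxe 0%E (sup_walk X j w).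

Definition pi_ X (j k : nat) : R :=
  fine (P [set w | walk_max X j w = (k%:R)%:E]).

(* P(\sum_(t in s) X_t = k); for s = [::] this is the point mass at 0. *)
Definition psum X s (k : int) : R := pmf (rv_sum X s) k%:~R.

End RandomWalk.

Definition mu_ (m : nat -> int) (s : seq nat) : int := \sum_(t <- s) m t.

Definition I_ (N j r : nat) : seq nat :=
  if (j < r)%N then index_iota j r
  else if j == r then [::]
  else index_iota 1 r ++ index_iota j N.+1.

(* The index r + 1, with N + 1 identified with 1. *)
Definition next_index (N r : nat) : nat := if r == N then 1%N else r.+1.

Section Coefficients.
Variables (R : realType) (D : int) (f : int -> R).

(* The list [a_(-D); a_(-D+1); ...; a_(-D+i)]; the recurrence for a_n is
   written here in terms of i = n + D, see a_rec below. *)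
Fixpoint a_list (i : nat) : seq R :=
  if i is i'.+1 then
    let s := a_list i' in
    rcons s ((f D)^-1 *
      ((if 0 <= i%:Z + D then s`_(absz (i%:Z + D)%R) else 0)
       - \sum_(1 <= k < i.+1) f (k%:Z + D) * s`_(i - k)))
  else [:: (f D)^-1].

(* The sequence a_n, extended by 0 to n < -D. *)
Definition a_ (n : int) : R :=
  if - D <= n then (a_list (absz (n + D)%R))`_(absz (n + D)%R) else 0.

Lemma size_a_list i : size (a_list i) = i.+1.
Proof. by elim: i => //= i IH; rewrite size_rcons IH. Qed.

Lemma nth_a_list i k : (k <= i)%N -> (a_list i)`_k = (a_list k)`_k.
Proof.
elim: i => [|i IH]; first by rewrite leqn0 => /eqP ->.
rewrite leq_eqVlt ltnS => /orP[/eqP -> //|ki].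
by rewrite /= nth_rcons size_a_list ltnS ki IH.
Qed.

Lemma a_init : a_ (- D) = (f D)^-1.
Proof. by rewrite /a_ lexx addNr. Qed.

Lemma a_rec (n : int) : D < 0 -> - D + 1 <= n ->
  a_ n = (f D)^-1 *
    ((if - (2 * D) <= n then a_ (n + D) else 0)
     - sumz 1 (n + D) (fun k => f (k + D) * a_ (n - k))).
Proof.
move=> D0 nD.
have [i iE] : exists i : nat, n = i.+1%:Z - D.
  by exists (absz (n + D - 1)%R); lia.
rewrite {1}/a_ ifT; last by lia.
have -> : absz (n + D)%R = i.+1 by lia.
rewrite /= nth_rcons size_a_list ltnn eqxx.
congr (_ * (_ - _)).
- have -> : (0 <= i.+1%:Z + D) = (- (2 * D) <= n) by lia.
  case: ifPn => // h; rewrite /a_ ifT; last by lia.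
  have -> : absz (n + D + D)%R = absz (i.+1%:Z + D)%R by congr absz; lia.
  by rewrite nth_a_list //; lia.
- rewrite /sumz ifT; last by lia.
  have -> : (absz (n + D - 1)%R).+1 = i.+1 by lia.
  rewrite big_add1 /=; apply: eq_big_nat => k /andP[_ ki].
  have -> : k.+1%:Z = 1 + k%:Z by lia.
  congr (_ * _); rewrite /a_ ifT; last by lia.
  have -> : absz (n - (1 + k%:Z) + D)%R = (i.+1 - k.+1)%N by lia.
  by rewrite nth_a_list //; lia.
Qed.

(* a_n^I for a block I with \sum_(t in I) m_t = mu and P(\sum_(t in I) X_t = k)
   = p k. For I empty (mu = 0, p the point mass at 0) this is a_n itself. *)
Definition aI_ (mu : int) (p : int -> R) (n : int) : R :=
  if mu - D <= n then sumz mu (n + D) (fun k => p k * a_ (n - k)) else 0.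

End Coefficients.

(* Main.v *)
(* Identify a function on the integers vanishing near -oo with a formal Laurent
   series. Let p_j be the law of X_j, G_j the distribution function of M_j and
   H_j the restriction of F_j to negative arguments, which is carried by
   [m_j, -1]. Since sup_(n >= j) (X_j + ... + X_n) = X_j + M_(j+1), conditioning
   on X_j gives G_j + H_j = F_j = p_j * G_(j+1). Going once around the period
   yields (f_N - 1) * G_j = \sum_r p_(I_jr) * H_r, and the recurrence for a_n says
   that a is the inverse of f_N - 1, so G_j = \sum_r a * p_(I_jr) * H_r. *)
Require Import Defs.
From HB Require Import structures.
From mathcomp Require Import all_boot all_order all_algebra.
From mathcomp Require Import all_classical all_reals all_analysis.
From mathcomp Require Import measurable_realfun.
From mathcomp Require Import zify.

Set Implicit Arguments.
Unset Strict Implicit.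
Unset Printing Implicit Defensive.

Import Order.TTheory GRing.Theory Num.Theory.
Import numFieldNormedType.Exports.

Local Open Scope classical_set_scope.
Local Open Scope ring_scope.

(** * Sums over integer intervals and Laurent series *)

Section Sumz.
Variable V : nmodType.
Implicit Types (a b c : int) (F G : int -> V).

Lemma sumz_nat a (n : nat) F :
  sumz a (a + n%:Z) F = \sum_(i < n.+1) F (a + i%:Z).
Proof.
rewrite /sumz ifT; last by lia.
by rewrite (_ : absz (a + n%:Z - a)%R = n) ?big_mkord //; lia.
Qed.

Lemma sumz_empty a b F : b < a -> sumz a b F = 0.
Proof. by move=> ba; rewrite /sumz ifF //; lia. Qed.

Lemma eq_sumz a b F G : (forall k, a <= k <= b -> F k = G k) ->
  sumz a b F = sumz a b G.
Proof.
move=> FG; rewrite /sumz; case: ifPn => // ab.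
by apply: eq_big_nat => i /andP[_ ib]; apply: FG; lia.
Qed.

Lemma sumz0 a b F : (forall k, a <= k <= b -> F k = 0) -> sumz a b F = 0.
Proof.
move=> F0; rewrite /sumz; case: ifPn => // ab.
by apply: big1_seq => i; rewrite mem_index_iota => ib; apply: F0; lia.
Qed.

Lemma sumzD a b F G :
  sumz a b (fun k => F k + G k) = sumz a b F + sumz a b G.
Proof. by rewrite /sumz; case: ifPn => _; rewrite ?addr0// big_split. Qed.

Lemma sumz_recl a b F : a <= b -> sumz a b F = F a + sumz (a + 1) b F.
Proof.
move=> ab; have [n ->] : exists n : nat, b = a + n%:Z by exists (absz (b - a)%R); lia.
rewrite sumz_nat big_ord_recl addr0; case: n => [|n].
  by rewrite big_ord0 sumz_empty //; lia.
have -> : a + n.+1%:Z = a + 1 + n%:Z by lia.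
rewrite sumz_nat; congr (_ + _); apply: eq_bigr => i _; congr F.
by rewrite lift0; lia.
Qed.

Lemma sumz1 a F : sumz a a F = F a.
Proof. by rewrite sumz_recl // sumz_empty ?addr0 //; lia. Qed.

Lemma sumz_shift c a b F : sumz (a + c) (b + c) F = sumz a b (fun k => F (k + c)).
Proof.
have [ab|ba] := leP a b; last by rewrite !sumz_empty //; lia.
have [n ->] : exists n : nat, b = a + n%:Z by exists (absz (b - a)%R); lia.
have -> : a + n%:Z + c = a + c + n%:Z by lia.
by rewrite !sumz_nat; apply: eq_bigr => i _; congr F; lia.
Qed.

Lemma sumz_recr a b F : a <= b + 1 -> sumz a (b + 1) F = sumz a b F + F (b + 1).
Proof.
move=> ab; have [->|ab'] := eqVneq a (b + 1).
  by rewrite sumz1 sumz_empty ?add0r //; lia.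
have [n ->] : exists n : nat, b = a + n%:Z by exists (absz (b - a)%R); lia.
have -> : a + n%:Z + 1 = a + n.+1%:Z by lia.
by rewrite !sumz_nat big_ord_recr.
Qed.

(** The case [b < a] is included: the sum up to [b] is then empty, and every term from [a] to [c]
    vanishes. *)
Lemma sumz_narrow a b c F : b <= c ->
  (forall k, a <= k -> b < k <= c -> F k = 0) -> sumz a c F = sumz a b F.
Proof.
move=> bc; have [n ->] : exists n : nat, c = b + n%:Z by exists (absz (c - b)%R); lia.
elim: n => [|n IH] F0; first by rewrite addr0.
have -> : b + n.+1%:Z = b + n%:Z + 1 by lia.
have [ab|ba] := leP a (b + n%:Z + 1); last by rewrite !sumz_empty //; lia.
rewrite sumz_recr // F0 ?addr0 //; last by lia.
by apply: IH => k ak bk; apply: F0 => //; lia.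
Qed.

End Sumz.

Lemma sumzN (V : zmodType) a b (F : int -> V) :
  sumz a b (fun k => - F k) = - sumz a b F.
Proof. by rewrite /sumz; case: ifPn => _; rewrite ?oppr0// sumrN. Qed.

Lemma mulr_sumzr (R : pzSemiRingType) (c : R) a b (F : int -> R) :
  c * sumz a b F = sumz a b (fun k => c * F k).
Proof. by rewrite /sumz; case: ifPn => _; rewrite ?mulr0// mulr_sumr. Qed.

(* The coefficient of x^n in the product of two Laurent series whose
   coefficients vanish below [a] and [b] respectively. *)
Definition cv (R : pzSemiRingType) (a b : int) (f g : int -> R) (n : int) : R :=
  sumz a (n - b) (fun k => f k * g (n - k)).

(** * Ring laws for products of Laurent series *)

Section Convolution.
Variable R : comNzRingType.
Implicit Types (a b c : int) (f g h : int -> R).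

Lemma cv_lt a b f g n : n < a + b -> cv a b f g n = 0.
Proof. by move=> nab; rewrite /cv sumz_empty //; lia. Qed.

(** Truncation at a size [K > n] does not affect coefficient [n], so commutativity and associativity
    of [cv] can be read off from polynomials. *)
Lemma cv_coef (K : nat) a b f g (n : nat) : (n < K)%N ->
  cv a b f g (a + b + n%:Z) =
  (\poly_(i < K) f (a + i%:Z) * \poly_(i < K) g (b + i%:Z))`_n.
Proof.
move=> nK; rewrite /cv; have -> : a + b + n%:Z - b = a + n%:Z by lia.
rewrite sumz_nat coefM; apply: eq_bigr => i _.
rewrite !coef_poly !ifT; [|have := ltn_ord i; lia..].
by congr (_ * g _); have := ltn_ord i; lia.
Qed.

Lemma cvC a b f g : cv a b f g =1 cv b a g f.
Proof.
move=> n; have [nab|nab] := ltP n (a + b); first by rewrite !cv_lt //; lia.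
have [k ->] : exists k : nat, n = a + b + k%:Z by exists (absz (n - (a + b))%R); lia.
by rewrite (cv_coef _ _ _ _ (ltnSn k)) (addrC a b) (cv_coef _ _ _ _ (ltnSn k)) mulrC.
Qed.

Lemma cvA a b c f g h :
  cv a (b + c) f (cv b c g h) =1 cv (a + b) c (cv a b f g) h.
Proof.
move=> n; have [nab|nab] := ltP n (a + b + c); first by rewrite !cv_lt //; lia.
have [k ->] : exists k : nat, n = a + b + c + k%:Z.
  by exists (absz (n - (a + b + c))%R); lia.
have kk := ltnSn k.
rewrite [RHS](cv_coef _ _ _ _ kk) -(addrA a b c) [LHS](cv_coef _ _ _ _ kk).
set p := \poly_(i < k.+1) f _; set r := \poly_(i < k.+1) h _.
pose q := \poly_(i < k.+1) g (b + i%:Z).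
(* Only coefficients of index at most [k] of the inner product occur, and there the truncated
   product agrees with [cv]. *)
transitivity ((p * (q * r))`_k).
  rewrite !coefM; apply: eq_bigr => i _; congr (_ * _).
  have ik : (k - i < k.+1)%N by lia.
  by rewrite coef_poly ik (cv_coef _ _ _ _ ik).
rewrite mulrA !coefM; apply: eq_bigr => i _; congr (_ * _).
have ik : (i < k.+1)%N by [].
by rewrite coef_poly ik (cv_coef _ _ _ _ ik).
Qed.

Lemma eq_cv a b f f' g g' : f =1 f' -> g =1 g' -> cv a b f g =1 cv a b f' g'.
Proof. by move=> ff gg n; apply: eq_sumz => k _; rewrite ff gg. Qed.

Lemma cvDr a b f g h n :
  cv a b f (fun k => g k + h k) n = cv a b f g n + cv a b f h n.
Proof. by rewrite /cv -sumzD; apply: eq_sumz => k _; rewrite mulrDr. Qed.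

Lemma cvNr a b f g n : cv a b f (fun k => - g k) n = - cv a b f g n.
Proof. by rewrite /cv -sumzN; apply: eq_sumz => k _; rewrite mulrN. Qed.

Lemma cv0r a b f n : cv a b f (fun=> 0) n = 0.
Proof. by rewrite /cv; apply: sumz0 => k _; rewrite mulr0. Qed.

(** Lowering the bound of the right factor only adds terms in which [g] vanishes. This brings series
    with different lower bounds to a common one before they are added. *)
Lemma cv_widenr a b b' f g : b' <= b -> (forall k, k < b -> g k = 0) ->
  cv a b' f g =1 cv a b f g.
Proof.
move=> bb g0 n; apply: sumz_narrow => [|k _ kb]; first by lia.
by rewrite g0 ?mulr0 //; lia.
Qed.

Lemma cv_delta b g : (forall k, k < b -> g k = 0) ->
  cv 0 b (fun k => (k == 0)%:R) g =1 g.
Proof.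
move=> g0 n; have [nb|nb] := ltP n b; first by rewrite cv_lt ?g0 //; lia.
rewrite /cv sumz_recl; last by lia.
rewrite eqxx mul1r subr0 sumz0 ?addr0 // => k kn.
by rewrite (_ : k == 0 = false) ?mul0r //; lia.
Qed.

End Convolution.

(** * The sequence [a_] as an inverse series *)

Lemma a_eq0 (R : realType) (D : int) (f : int -> R) n : n < - D -> a_ D f n = 0.
Proof. by move=> nD; rewrite /a_ ifF //; lia. Qed.

Lemma aI_cv (R : realType) (D mu : int) (f p : int -> R) :
  aI_ D f mu p =1 cv mu (- D) p (a_ D f).
Proof.
move=> n; rewrite /aI_ /cv opprK; case: ifPn => // h.
by rewrite sumz_empty //; lia.
Qed.

(* The recurrence says that [a_] is the inverse of the Laurent series [f - 1]. *)
Lemma cv_a (R : realType) (D : int) (f : int -> R) (n : int) :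
  D < 0 -> f D != 0 -> cv D (- D) f (a_ D f) n = a_ D f n + (n == 0)%:R.
Proof.
move=> D0 fD; have [n0|n0|->] := ltgtP n 0.
- by rewrite cv_lt ?a_eq0 ?addr0 //; lia.
- rewrite addr0 /cv opprK sumz_recl; last by lia.
  (* The leading term [f D * a_ D f (n - D)] is expanded by the recurrence at [n - D]. Its sum
     cancels the rest of the convolution and its first term is [a_ D f n], the case condition there
     being [- D <= n]. *)
  rewrite a_rec //; last by lia.
  rewrite mulrA divff // mul1r -addrA.
  have -> : n - D + D = n by lia.
  rewrite [X in - X + _](_ : _ = sumz (D + 1) (n + D) (fun k => f k * a_ D f (n - k))).
    rewrite addNr addr0; case: ifPn => // h.
    by rewrite a_eq0 //; lia.
  rewrite (addrC D 1) sumz_shift; apply: eq_sumz => k _.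
  by congr (_ * a_ _ _ _); lia.
(* The single term is [f D * a_ D f (- D) = 1], while [a_ D f 0 = 0] because [0 < - D]. *)
- rewrite /cv sub0r opprK sumz1 sub0r a_init mulfV // a_eq0 ?add0r //; lia.
Qed.

(** Provides one lower bound valid for finitely many Laurent series at once, and also below a
    prescribed [c]. *)
Lemma finite_lower_bound (c : int) (g : nat -> int) (M : nat) :
  exists2 b : int, b <= c & forall t, (1 <= t <= M)%N -> b <= g t.
Proof.
elim: M => [|M [b bc bg]]; first by exists c => // t; lia.
exists (Num.min b (g M.+1)) => [|t tM]; first by lia.
have [->|tM'] := eqVneq t M.+1; first by lia.
by have := bg t; lia.
Qed.

(** * Finite-horizon walks *)

Section Probability.
Context {d : measure_display} {T : measurableType d} {R : realType}.
Variable P : probability T R.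

Definition pr (A : set T) : R := fine (P A).

Lemma prE A : measurable A -> (pr A)%:E = P A.
Proof. by move=> mA; rewrite /pr fineK // fin_num_measure. Qed.

Lemma pr0 : pr set0 = 0. Proof. by rewrite /pr measure0. Qed.

Lemma prT : pr setT = 1. Proof. by rewrite /pr probability_setT. Qed.

Lemma prU A B : measurable A -> measurable B -> A `&` B = set0 ->
  pr (A `|` B) = pr A + pr B.
Proof.
by move=> mA mB AB; rewrite /pr measureU // fineD // fin_num_measure.
Qed.

(** The bounds [m t <= X t] hold only almost surely; this allows events to be compared pointwise off
    an exceptional set. *)
Lemma eq_pr_off_null A B Z : measurable A -> measurable B -> measurable Z ->
  P Z = 0%E -> (forall w, ~ Z w -> A w <-> B w) -> pr A = pr B.
Proof.
move=> mA mB mZ Z0 AB.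
have drop C : measurable C -> P C = P (C `\` Z).
  move=> mC; rewrite (measureDI P mC mZ) [X in (_ + X)%E](_ : _ = 0%E) ?adde0 //.
  apply: (@subset_measure0 _ _ _ P _ Z) => //; exact: measurableI.
rewrite /pr (drop A mA) (drop B mB); congr (fine (P _)).
by apply/seteqP; split=> w [Cw Zw]; split=> //; apply/AB.
Qed.

Lemma measurable_preimage_le (Y : {RV P >-> R}) (x : R) :
  measurable [set w | Y w <= x].
Proof.
have := measurable_funPTI Y (measurable_itv `]-oo, x]).
by rewrite set_itvNyc.
Qed.

Lemma measurable_preimage_eq (Y : {RV P >-> R}) (x : R) :
  measurable [set w | Y w = x].
Proof. exact: (measurable_funPTI Y (measurable_set1 x)). Qed.

Lemma pr_partition (Y : {RV P >-> R}) (B : set T) (a b : int) :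
  (forall w, Y w \is a Num.int) -> measurable B ->
  pr (B `&` [set w | a%:~R <= Y w <= b%:~R]) =
  sumz a b (fun k => pr (B `&` [set w | Y w = k%:~R])).
Proof.
move=> Yint mB.
have m1 k : measurable (B `&` [set w | Y w = k%:~R]).
  by apply: measurableI => //; exact: measurable_preimage_eq.
have m2 c : measurable (B `&` [set w | a%:~R <= Y w <= c%:~R]).
  apply: measurableI => //.
  have := measurable_funPTI Y (measurable_itv `[a%:~R, c%:~R]).
  by rewrite set_itvcc.
have [ab|ba] := leP a b; last first.
  rewrite sumz_empty // (_ : _ `&` _ = set0) ?pr0 //.
  apply/seteqP; split=> // w [_ /= /andP[h1 h2]].
  by have := le_trans h1 h2; rewrite ler_int leNgt ba.
(* Starting from [a - 1] makes the base case of the induction the empty interval. *)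
have [n ->] : exists n : nat, b = a - 1 + n%:Z by exists (absz (b - a + 1)%R); lia.
elim: n => [|n IH].
  rewrite addr0 sumz_empty; last by lia.
  rewrite (_ : _ `&` _ = set0) ?pr0 //.
  apply/seteqP; split=> // w [_ /= /andP[h1 h2]].
  by have := le_trans h1 h2; rewrite ler_int; lia.
have -> : a - 1 + n.+1%:Z = a - 1 + n%:Z + 1 by lia.
rewrite sumz_recr -?IH; last by lia.
rewrite -prU //.
  congr pr; rewrite -setIUr; congr (_ `&` _); apply/seteqP; split=> w /=.
    have /intrP[z ->] := Yint w.
    rewrite !ler_int => h; have [->|zn] := eqVneq z (a - 1 + n%:Z + 1); first by right.
    by left; lia.
  have /intrP[z ->] := Yint w.
  by rewrite !ler_int => -[h|/intr_inj h]; lia.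
apply/seteqP; split=> // w [[_ /= +] [_ +]].
have /intrP[z ->] := Yint w.
by rewrite !ler_int => h /intr_inj h'; lia.
Qed.

End Probability.

Section Walk.
Context {d : measure_display} {T : measurableType d} {R : realType}.
Variables (P : probability T R) (X : nat -> {RV P >-> R}) (m : nat -> int).
Hypothesis X_int : forall t, (1 <= t)%N -> forall w, X t w \is a Num.int.
Hypothesis X_indep : mutually_independent [set k : nat | (1 <= k)%N] X.
Hypothesis X_ge : forall t, (1 <= t)%N -> P [set w | X t w < (m t)%:~R] = 0%E.

(** A single null set for all indices from 1 on, off which the lower bounds of all partial sums hold
    simultaneously. *)
Definition low_set : set T := \bigcup_t [set w | X t.+1 w < (m t.+1)%:~R].

Lemma measurable_low_set : measurable low_set.
Proof.
apply: bigcup_measurable => t _.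
by have := measurable_funPTI (X t.+1) (measurable_itv `]-oo, (m t.+1)%:~R[);
  rewrite set_itvNyo.
Qed.

Lemma low_set_null : P low_set = 0%E.
Proof.
apply/negligibleP; first exact: measurable_low_set.
apply: negligible_bigcup => t; apply/negligibleP; last exact: X_ge.
by have := measurable_funPTI (X t.+1) (measurable_itv `]-oo, (m t.+1)%:~R[);
  rewrite set_itvNyo.
Qed.

Lemma low_setN w t : ~ low_set w -> (1 <= t)%N -> (m t)%:~R <= X t w.
Proof.
move=> wZ; case: t => // t _; rewrite leNgt; apply/negP => h.
by apply: wZ; exists t.
Qed.

Lemma rv_sum_ge w s : ~ low_set w -> all (leq 1) s ->
  (mu_ m s)%:~R <= rv_sum X s w.
Proof.
move=> wZ; rewrite rv_sumE /mu_; elim: s => [|t s IH] /=; first by rewrite !big_nil.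
by case/andP => t1 s1; rewrite !big_cons rmorphD lerD ?IH ?low_setN.
Qed.

Lemma rv_sum_int w s : all (leq 1) s -> rv_sum X s w \is a Num.int.
Proof.
rewrite rv_sumE; elim: s => [|t s IH] /=; first by rewrite big_nil rpred0.
by case/andP => t1 s1; rewrite big_cons rpredD ?IH ?X_int.
Qed.

Lemma rv_sum_cons t s w : rv_sum X (t :: s) w = X t w + rv_sum X s w.
Proof. by rewrite !rv_sumE big_cons. Qed.

(** Product form is the shape to which [mutually_independent] applies directly, and it is preserved
    when a new coordinate is fixed. *)
Definition cylinder (s : seq nat) (A : set T) : Prop :=
  exists2 B : nat -> set R, (forall k, measurable (B k)) &
    A = \bigcap_(t in [set` s]) (X t @^-1` B t).

Lemma cylinderT : cylinder [::] setT.
Proof.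
by exists (fun=> setT) => //; apply/esym/seteqP; split.
Qed.

Lemma measurable_cylinder s A : cylinder s A -> measurable A.
Proof.
case=> B mB ->; rewrite bigcap_seq; elim/big_rec : _ => [//|t C _ mC].
by apply: measurableI => //; exact: (measurable_funPTI (X t)).
Qed.

Lemma cylinder_cons t s A (k : R) : t \notin s -> cylinder s A ->
  cylinder (t :: s) (A `&` [set w | X t w = k]).
Proof.
move=> ts [B mB ->].
exists (fun i => if i == t then [set k] else B i) => [i|].
  by case: ifP => // _; exact: measurable_set1.
apply/seteqP; split => w /=.
  move=> [h tk] i /=; rewrite inE => /predU1P[->|si]; first by rewrite eqxx.
  by rewrite (_ : i == t = false); [exact: h|apply: contraNF ts => /eqP <-].
move=> h; split; last by have := h t; rewrite /= inE eqxx; exact.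
move=> i /= si; have := h i; rewrite /= inE si orbT.
rewrite (_ : i == t = false); last by apply: contraNF ts => /eqP <-.
exact.
Qed.

Lemma pr_cylinder_cons t s A (k : R) : uniq (t :: s) -> all (leq 1) (t :: s) ->
  cylinder s A -> pr P (A `&` [set w | X t w = k]) = pr P A * pr P [set w | X t w = k].
Proof.
move=> uts ats cA; have := cA; case=> B mB AE.
have ts : t \notin s by case/andP: uts.
have h0 i : i \in t :: s -> (1 <= i)%N by move/(allP ats).
(* One family serves two uses of independence, for [t :: s] and for [s]; the override at [t] leaves
   [A] unchanged since [t] is not in [s]. *)
pose B' i := if i == t then [set k] else B i.
have mB' i : measurable (B' i) by rewrite /B'; case: ifP => // _; exact: measurable_set1.
have AE' : A = \bigcap_(i in [set` s]) (X i @^-1` B' i).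
  rewrite AE; apply: eq_bigcapr => i /= si; rewrite /B' ifN //.
  by apply: contraNneq ts => <-.
have := X_indep uts h0 mB'.
rewrite big_cons -X_indep //; first last.
- by move=> i si; apply: h0; rewrite inE si orbT.
- by case/andP: uts.
rewrite -AE' bigcap_seq big_cons -bigcap_seq -AE' {1 2}/B' eqxx setIC => PE.
rewrite /pr; transitivity (fine (P (X t @^-1` [set k]) * P A)); first by rewrite -PE.
have mXk : measurable (X t @^-1` [set k]) by exact: measurable_preimage_eq.
by rewrite fineM ?fin_num_measure //; [exact: mulrC|exact: measurable_cylinder cA].
Qed.

(* Conditioning on the value of [X t]; outside a null set it is at least [m t],
   so the sum is finite as soon as [X t] is bounded on the event. *)
Lemma pr_first_step t s A E (b : int) (E' : int -> set T) :
  (1 <= t)%N -> cylinder s A -> measurable E ->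
  (forall w, ~ low_set w -> E w -> X t w <= b%:~R) ->
  (forall k w, X t w = k%:~R -> E w <-> E' k w) ->
  pr P (A `&` E) =
  sumz (m t) b (fun k => pr P ((A `&` [set w | X t w = k%:~R]) `&` E' k)).
Proof.
move=> t1 cA mE Eb EE'; have mA := measurable_cylinder cA.
have mAE : measurable (A `&` E) by apply: measurableI.
have mitv : measurable [set w | (m t)%:~R <= X t w <= b%:~R].
  have := measurable_funPTI (X t) (measurable_itv `[(m t)%:~R, b%:~R]).
  by rewrite set_itvcc.
transitivity (pr P ((A `&` E) `&` [set w | (m t)%:~R <= X t w <= b%:~R])).
  apply: (eq_pr_off_null _ _ measurable_low_set low_set_null) => //.
    by apply: measurableI.
  move=> w wZ; split=> [[Aw Ew]|[[Aw Ew] _]] //; split=> //=.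
  by rewrite low_setN //= Eb.
rewrite pr_partition //; last exact: X_int.
apply: eq_sumz => k _; congr pr; rewrite setIAC.
apply/seteqP; split => w [[Aw Xw]] Ew; split=> //; exact/(EE' k w Xw).
Qed.

Definition step_law t (k : int) : R := pr P [set w | X t w = k%:~R].

(** The law of the sum as an iterated convolution: it involves only the individual step laws, and
    associativity and commutativity of [cv] apply to it. *)
Fixpoint sum_law (s : seq nat) : int -> R :=
  if s is t :: s' then cv (m t) (mu_ m s') (step_law t) (sum_law s')
  else fun k => (k == 0)%:R.

(** The event [A] over the other indices [s'] strengthens the induction: each step fixes the value
    of one [X t] and moves [t] from the sum into the cylinder. *)
Lemma pr_rv_sum s s' A k : uniq (s ++ s') -> all (leq 1) (s ++ s') ->
  cylinder s' A ->
  pr P (A `&` [set w | rv_sum X s w = k%:~R]) = pr P A * sum_law s k.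
Proof.
elim: s s' A k => [|t s IH] s' A k us as' cA /=.
  have -> : [set w | rv_sum X [::] w = k%:~R] = if k == 0 then setT else set0.
    apply/seteqP; split => w /=; rewrite rv_sumE big_nil.
      by move/eqP; rewrite eq_sym intr_eq0 => ->.
    by case: eqP => // ->.
  by case: eqP => _; rewrite ?setIT ?setI0 ?pr0 ?mulr1 ?mulr0.
have t1 : (1 <= t)%N by case/andP: as'.
have us' : uniq (s ++ t :: s').
  by move: us; rewrite -[X in uniq X]/([:: t] ++ s ++ s') uniq_catCA.
have as'' : all (leq 1) (s ++ t :: s').
  by move: as'; rewrite /= !all_cat /= andbCA.
(* Off the null set the remaining sum is at least [mu_ m s], which bounds [X t] by [k - mu_ m s]. *)
rewrite (pr_first_step (b := k - mu_ m s)
  (E' := fun l => [set w | rv_sum X s w = (k - l)%:~R]) t1 cA); last 3 first.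
- exact: measurable_preimage_eq.
- move=> w wZ /=; rewrite rv_sum_cons => E; rewrite rmorphB /= lerBrDr -E lerD2l.
  apply: rv_sum_ge => //; by move: as''; rewrite all_cat => /andP[].
- move=> l w /= Xw; rewrite rv_sum_cons Xw rmorphB /=.
  by split=> [<-|->]; rewrite ?(addrC _ (rv_sum _ _ _)) ?addrK // addrC subrK.
rewrite /cv mulr_sumzr; apply: eq_sumz => l _.
have tss : uniq (t :: s') by move: us'; rewrite cat_uniq => /and3P[].
rewrite (IH (t :: s')) //; last first.
  by apply: cylinder_cons => //; case/andP: tss.
rewrite (pr_cylinder_cons (s := s')) ?mulrA //.
by move: as''; rewrite all_cat => /andP[].
Qed.

Lemma psumE s : uniq s -> all (leq 1) s -> psum X s =1 sum_law s.
Proof.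
move=> us as' k; have := @pr_rv_sum s [::] setT k.
by rewrite cats0 setTI prT mul1r => <- //; exact: cylinderT.
Qed.

Lemma step_law_lt t k : (1 <= t)%N -> k < m t -> step_law t k = 0.
Proof.
move=> t1 kt; rewrite /step_law -(pr0 P).
apply: (eq_pr_off_null _ _ measurable_low_set low_set_null) => //.
  exact: measurable_preimage_eq.
move=> w wZ; split=> //= Xw.
by have := low_setN wZ t1; rewrite Xw ler_int leNgt kt.
Qed.

Lemma sum_law_lt s k : k < mu_ m s -> sum_law s k = 0.
Proof.
case: s => [|t s] /=; rewrite /mu_ ?big_nil ?big_cons => h.
  by rewrite (_ : k == 0 = false) //; lia.
by rewrite cv_lt.
Qed.

Lemma mu_cat s1 s2 : mu_ m (s1 ++ s2) = mu_ m s1 + mu_ m s2.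
Proof. exact: big_cat. Qed.

Lemma sum_law_cat s1 s2 :
  sum_law (s1 ++ s2) =1 cv (mu_ m s1) (mu_ m s2) (sum_law s1) (sum_law s2).
Proof.
elim: s1 => [|t s1 IH] k /=.
  by rewrite /mu_ big_nil cv_delta // => l; exact: sum_law_lt.
rewrite mu_cat (eq_cv _ _ (fun=> erefl) IH) cvA.
by rewrite [mu_ m (t :: _)]/mu_ big_cons.
Qed.

(** At the bottom of the support the convolution has one term, the product of the lowest atoms. This
    later gives [f D != 0]. *)
Lemma sum_law_mu_gt0 s : (forall t, t \in s -> 0 < step_law t (m t)) ->
  0 < sum_law s (mu_ m s).
Proof.
elim: s => [|t s IH] h /=; first by rewrite /mu_ big_nil eqxx.
rewrite {2}/mu_ big_cons /cv addrK sumz1 (addrC (m t)) addrK.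
by rewrite mulr_gt0 ?h ?inE ?eqxx // IH // => i si; rewrite h // inE si orbT.
Qed.

Definition walk_le (h j : nat) (x : int) : set T :=
  [set w | forall n, (j <= n < j + h)%N -> rv_sum X (index_iota j n.+1) w <= x%:~R].

Lemma measurable_walk_le h j x : measurable (walk_le h j x).
Proof.
elim: h => [|h IH].
  rewrite (_ : walk_le _ _ _ = setT) //.
  by apply/seteqP; split=> // w _ n; lia.
rewrite (_ : walk_le _ _ _ = walk_le h j x `&`
    [set w | rv_sum X (index_iota j (j + h).+1) w <= x%:~R]).
  by apply: measurableI => //; exact: measurable_preimage_le.
apply/seteqP; split => w.
  by move=> H; split => [n hn|]; apply: H; lia.
move=> [H1 H2] n hn; have [->//|nE] := eqVneq n (j + h)%N.
by apply: H1; lia.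
Qed.

(** The distribution function of the maximum of [h] partial sums, by conditioning on the first step.
    The range [k <= x] encodes the constraint on the first partial sum; horizon 0 imposes none. *)
Fixpoint walk_law (h j : nat) (x : int) : R :=
  if h is h'.+1 then
    sumz (m j) x (fun k => step_law j k * walk_law h' j.+1 (x - k))
  else 1.

Lemma index_iota_cons j n : (j <= n)%N ->
  index_iota j n.+1 = j :: index_iota j.+1 n.+1.
Proof. by move=> jn; rewrite /index_iota subSn. Qed.

(* Keeping a cylinder [A] over past indices in the statement lets the induction
   consume one step at a time with independence of single variables only. *)
Lemma pr_walk_le_cylinder h j x s A : (1 <= j)%N -> uniq s -> all (leq 1) s ->
  all (gtn j) s -> cylinder s A ->
  pr P (A `&` walk_le h j x) = pr P A * walk_law h j x.
Proof.
elim: h j x s A => [|h IH] j x s A j1 us s1 sj cA /=.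
  rewrite (_ : walk_le _ _ _ = setT) ?setIT ?mulr1 //.
  by apply/seteqP; split=> // w _ n; lia.
have js : j \notin s by apply/negP => /(allP sj) /=; rewrite ltnn.
(* The constraint at [n = j] is [X j <= x], hence the bound [x] and the empty event for [k > x]; the
   other constraints are those of the walk from [j.+1] at level [x - k]. *)
rewrite (pr_first_step (b := x)
  (E' := fun k => if k <= x then walk_le h j.+1 (x - k) else set0) j1 cA); last 3 first.
- exact: measurable_walk_le.
- move=> w _ /(_ j) H; apply: le_trans (H _); last by lia.
  by rewrite rv_sumE big_nat1.
- move=> k w Xw; split.
    move=> H; have := H j; rewrite rv_sumE big_nat1 Xw ler_int => -> //; last by lia.
    move=> n hn; have := H n; rewrite index_iota_cons; last by lia.
    rewrite rv_sum_cons Xw rmorphB /= lerBrDl; apply; lia.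
  case: ifP => // kx H n hn; have [<-|jn] := eqVneq j n.
    by rewrite rv_sumE big_nat1 Xw ler_int.
  rewrite index_iota_cons; last by lia.
  by rewrite rv_sum_cons Xw -lerBrDl -rmorphB; apply: H; lia.
rewrite mulr_sumzr; apply: eq_sumz => k /andP[_ kx]; rewrite kx.
rewrite (IH j.+1 _ (j :: s)) //=; last 4 first.
- by rewrite js.
- by rewrite j1.
- by rewrite ltnSn; apply: sub_all sj => i /= ij; rewrite ltnS ltnW.
- exact: cylinder_cons.
by rewrite (pr_cylinder_cons (s := s)) ?mulrA //= ?js ?j1.
Qed.

Lemma pr_walk_le h j x : (1 <= j)%N -> pr P (walk_le h j x) = walk_law h j x.
Proof.
move=> j1; have := @pr_walk_le_cylinder h j x [::] setT j1.
by rewrite setTI prT mul1r => -> //; exact: cylinderT.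
Qed.

(** * Passage to the infinite horizon *)

Lemma sup_walk_leE j (x : int) :
  [set w | (sup_walk X j w <= (x%:~R)%:E)%E] = \bigcap_h walk_le h j x.
Proof.
apply/seteqP; split => w /=.
  move=> H h _ n /andP[jn _]; rewrite -lee_fin; apply: le_trans H.
  by apply: ereal_sup_ubound; exists n.
move=> H; apply: ge_ereal_sup => _ [n /= jn <-]; rewrite lee_fin.
by apply: (H n.+1) => //; lia.
Qed.

(** The events [walk_le h j x] decrease in [h] to the event defining [F_infty], so continuity from
    above of [P] applies. *)
Lemma F_infty_cvg j x : (1 <= j)%N ->
  walk_law h j x @[h --> \oo] --> F_infty X j x.
Proof.
move=> j1; rewrite /F_infty sup_walk_leE.
have mB : measurable (\bigcap_h walk_le h j x).
  by apply: bigcap_measurable => [|k _]; [exists 0%N|exact: measurable_walk_le].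
under eq_fun do rewrite -pr_walk_le //.
apply: fine_cvg; rewrite fineK ?fin_num_measure //.
apply: nonincreasing_cvg_mu => //.
- by rewrite ltey_eq fin_num_measure //; exact: measurable_walk_le.
- by move=> i; exact: measurable_walk_le.
- move=> h h' hh; apply/subsetPset => w H n hn; apply: H; lia.
Qed.

(** The limit is taken termwise in the recursion of [walk_law], whose sum over [m j <= k <= x] is
    finite. *)
Lemma F_infty_step j x : (1 <= j)%N ->
  F_infty X j x = sumz (m j) x (fun k => step_law j k * F_infty X j.+1 (x - k)).
Proof.
move=> j1; apply: (@cvg_unique _ (@Rhausdorff R) (walk_law h.+1 j x @[h --> \oo])).
  by have := F_infty_cvg (x := x) j1; rewrite -cvg_shiftS.
rewrite /= /sumz; case: ifPn => _; last exact: cvg_cst.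
apply: cvg_big => [|i _]; first exact: add_continuous.
by apply: cvgM; [exact: cvg_cst|exact: F_infty_cvg].
Qed.

Lemma F_infty_lt j x : (1 <= j)%N -> x < m j -> F_infty X j x = 0.
Proof. by move=> j1 xm; rewrite F_infty_step // sumz_empty. Qed.

Lemma cdf_step_law t x : (1 <= t)%N ->
  fine (cdf (X t) x%:~R) = sumz (m t) x (step_law t).
Proof.
move=> t1; have := @pr_first_step t [::] setT [set w | X t w <= x%:~R] x
  (fun k => if k <= x then setT else set0) t1 cylinderT (measurable_preimage_le _ _).
rewrite setTI => E.
rewrite (_ : fine _ = pr P [set w | X t w <= x%:~R]); last first.
  by rewrite /cdf set_itvNyc.
rewrite E //; last first.
  by move=> k w /= ->; rewrite ler_int; case: ifP.
by apply: eq_sumz => k /andP[_ ->]; rewrite setIT setTI.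
Qed.

(** * The law of the maximum *)

Lemma measurable_sup_walk_le j (x : int) :
  measurable [set w | (sup_walk X j w <= (x%:~R)%:E)%E].
Proof.
rewrite sup_walk_leE.
by apply: bigcap_measurable => [|k _]; [exists 0%N|exact: measurable_walk_le].
Qed.

(** Partial sums are integers, so if their supremum is below [x + 1], each of them is at most
    [x]. *)
Lemma sup_walk_succ j (x : int) w : (1 <= j)%N ->
  ~ (sup_walk X j w <= (x%:~R)%:E)%E -> (((x + 1)%:~R)%:E <= sup_walk X j w)%E.
Proof.
move=> j1; apply: contra_notP => /negP; rewrite -ltNge => lt_sup.
apply: ge_ereal_sup => _ [n /= jn <-]; rewrite lee_fin.
have : ((rv_sum X (index_iota j n.+1) w)%:E < ((x + 1)%:~R)%:E)%E.
  by apply: le_lt_trans lt_sup; apply: ereal_sup_ubound; exists n.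
have /intrP[z ->] : rv_sum X (index_iota j n.+1) w \is a Num.int.
  by apply: rv_sum_int; apply/allP => t; rewrite mem_index_iota /=; lia.
by rewrite lte_fin ltr_int ler_int; lia.
Qed.

Lemma pi0E j : pi_ X j 0 = F_infty X j 0.
Proof.
congr (fine (P _)); apply/seteqP; split=> w; rewrite /walk_max /=.
  by move=> <-; rewrite le_max lexx orbT.
by move=> h; rewrite max_l.
Qed.

(** At a positive value the maximum with 0 is inactive, so the maximum equals [k.+1] exactly when
    the supremum is at most [k.+1] but not at most [k]. *)
Lemma F_infty_succ j (k : nat) : (1 <= j)%N ->
  F_infty X j k.+1%:Z = F_infty X j k%:Z + pi_ X j k.+1.
Proof.
move=> j1; pose S (x : int) := [set w | (sup_walk X j w <= (x%:~R)%:E)%E].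
have maxE : [set w | walk_max X j w = (k.+1%:R)%:E] = S k.+1 `\` S k.
  apply/seteqP; split=> w; rewrite /S /walk_max /=.
    move=> E; have kE : (k.+1%:~R)%:E = maxe 0%E (sup_walk X j w) :> \bar R by rewrite E.
    split; first by rewrite kE le_max lexx orbT.
    move=> le_k; have : (maxe 0%E (sup_walk X j w) <= (k%:~R)%:E)%E.
      by rewrite ge_max le_k lee_fin ler0z.
    by rewrite -kE lee_fin ler_int; lia.
  move=> [le_k1 /(sup_walk_succ j1)]; rewrite (_ : k%:Z + 1 = k.+1%:Z); last by lia.
  move=> ge_k1; have -> : sup_walk X j w = (k.+1%:~R)%:E.
    by apply/eqP; rewrite eq_le le_k1.
  by rewrite max_r // lee_fin ler0z.
rewrite /F_infty /pi_ maxE -/(S k) -/(S k.+1) -!/(pr P _) -prU.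
- congr pr; apply/seteqP; split=> w; rewrite /S /=.
    by have [|] := pselect (sup_walk X j w <= (k%:~R)%:E)%E; [left|right].
  by move=> [h|[]//]; apply: le_trans h _; rewrite lee_fin ler_int lez_nat.
- exact: measurable_sup_walk_le.
- by apply: measurableD; exact: measurable_sup_walk_le.
- by apply/seteqP; split=> // w [h1 [_ /(_ h1)]].
Qed.

Lemma sum_pi j (k : nat) : (1 <= j)%N ->
  \sum_(i < k.+1) pi_ X j i = F_infty X j k%:Z.
Proof.
move=> j1; elim: k => [|k IH]; first by rewrite big_ord1 pi0E.
by rewrite big_ord_recr /= IH F_infty_succ.
Qed.

(* Both sides are P(X_r + M_(r+1) <= l): conditioning on M_(r+1) gives the left
   one, conditioning on X_r the right one. *)
Lemma sum_pi_cdf r r' l : (1 <= r)%N -> (1 <= r')%N ->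
  (forall x, F_infty X r' x = F_infty X r.+1 x) -> m r <= l ->
  \sum_(0 <= i < (absz (l - m r)%R).+1)
    pi_ X r' i * fine (cdf (X r) (l - i%:Z)%:~R) = F_infty X r l.
Proof.
move=> r1 r'1 Fr' ml.
pose one (z : int) : R := (0 <= z)%R%:R.
pose pz (z : int) : R := pi_ X r' (absz z).
pose p := step_law r.
have onecv b (f : int -> R) z : cv b 0 f one z = sumz b z f.
  rewrite /cv subr0; apply: eq_sumz => k kz.
  by rewrite /one (_ : 0 <= z - k) ?mulr1 //; lia.
have pz1 z : 0 <= z -> cv 0 0 pz one z = F_infty X r.+1 z.
  move=> z0; rewrite onecv -Fr'.
  have -> : z = (absz z)%:Z by lia.
  rewrite -sum_pi // -[X in sumz _ X]add0r sumz_nat.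
  by apply: eq_bigr => i _; rewrite add0r.
transitivity (cv 0 (m r + 0) pz (cv (m r) 0 p one) l).
  rewrite /cv addr0 (_ : l - m r = 0 + (absz (l - m r)%R)%:Z); last by lia.
  rewrite sumz_nat big_mkord (_ : absz (0 + _)%R = absz (l - m r)%R); last by lia.
  apply: eq_bigr => i _; rewrite add0r; congr (_ * _).
  by rewrite -/(cv (m r) 0 p one _) onecv cdf_step_law.
(* Regroups [pz * (p * one)] as [p * (pz * one)], which is the first-step formula for
   [F_infty X r]. *)
rewrite cvA (eq_cv _ _ (cvC 0 (m r) pz p) (fun=> erefl)) add0r.
have := cvA (m r) 0 0 p pz one l; rewrite !addr0 => <-.
rewrite F_infty_step // /cv subr0.
apply: eq_sumz => k kl; congr (_ * _); rewrite -/(cv 0 0 pz one _).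
by apply: pz1; lia.
Qed.

(** * The periodic walk *)

Variable N : nat.
Hypothesis N_gt0 : (0 < N)%N.
Hypothesis m_periodic : forall t, (1 <= t)%N -> m (t + N)%N = m t.
Hypothesis law_periodic : forall t, (1 <= t)%N ->
  step_law (t + N)%N =1 step_law t.

Lemma walk_law_periodic h j x : (1 <= j)%N ->
  walk_law h (j + N) x = walk_law h j x.
Proof.
elim: h j x => //= h IH j x j1; rewrite m_periodic //; apply: eq_sumz => k _.
by rewrite law_periodic // -addSn IH.
Qed.

(** Only [m] and the step laws enter [walk_law], so periodicity holds at each finite horizon and
    passes to the limit. *)
Lemma F_infty_periodic j x : (1 <= j)%N ->
  F_infty X (j + N) x = F_infty X j x.
Proof.
move=> j1.
apply: (@cvg_unique _ (@Rhausdorff R) (walk_law h j x @[h --> \oo])); last first.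
  exact: F_infty_cvg.
rewrite (_ : (fun h => walk_law h j x) = (fun h => walk_law h (j + N) x)).
  by apply: F_infty_cvg; lia.
by apply/funext => h; rewrite walk_law_periodic.
Qed.

(** [F_nneg j] is the series G_j, the distribution function of [walk_max X j]; [F_neg j] is H_j. *)
Definition F_nneg j (x : int) : R := if 0 <= x then F_infty X j x else 0.
Definition F_neg j (x : int) : R := if x < 0 then F_infty X j x else 0.

Lemma F_nneg_lt j x : x < 0 -> F_nneg j x = 0.
Proof. by move=> x0; rewrite /F_nneg ifF //; lia. Qed.

Lemma F_neg_lt j x : (1 <= j)%N -> x < m j -> F_neg j x = 0.
Proof. by move=> j1 xm; rewrite /F_neg F_infty_lt // if_same. Qed.

(** In [F_infty_step] the argument [x - k] is nonnegative, so there [F_infty X j.+1] may be replaced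
    by [F_nneg j.+1]. *)
Lemma F_nnegE j :  (1 <= j)%N ->
  F_nneg j =1 (fun x => cv (m j) 0 (step_law j) (F_nneg j.+1) x - F_neg j x).
Proof.
move=> j1 x; have -> : cv (m j) 0 (step_law j) (F_nneg j.+1) x = F_infty X j x.
  rewrite F_infty_step // /cv subr0; apply: eq_sumz => k kx.
  by rewrite /F_nneg ifT //; lia.
by rewrite /F_nneg /F_neg leNgt; case: ltP => _; rewrite ?subrr ?subr0.
Qed.

Lemma sum_law1 t : (1 <= t)%N -> sum_law [:: t] =1 step_law t.
Proof.
move=> t1 k /=; rewrite cvC /mu_ big_nil cv_delta // => l; exact: step_law_lt.
Qed.

Lemma index_iota_recr j r : (j <= r)%N -> index_iota j r.+1 = index_iota j r ++ [:: r].
Proof.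
by move=> jr; rewrite /index_iota subSn // -addn1 iotaD /= subnKC.
Qed.

(* The prefix [s] allows the telescoping to be resumed at index 1 once it has
   reached N + 1. *)
Lemma cv_sum_law_telescope s j r n : (1 <= j <= r)%N ->
  cv (mu_ m s) 0 (sum_law s) (F_nneg j) n =
  cv (mu_ m (s ++ index_iota j r)) 0 (sum_law (s ++ index_iota j r)) (F_nneg r) n
  - \sum_(j <= t < r) cv (mu_ m (s ++ index_iota j t)) (m t)
      (sum_law (s ++ index_iota j t)) (F_neg t) n.
Proof.
case/andP=> j1; elim: r => [|r IH] jr; first by lia.
have [->|jr'] := eqVneq j r.+1.
  by rewrite big_geq // subr0 /index_iota subnn cats0.
have {}jr : (j <= r)%N by lia.
have r1 : (1 <= r)%N by lia.
rewrite IH // big_nat_recr //= opprD addrA addrAC; congr (_ - _).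
set u := s ++ index_iota j r.
have -> : s ++ index_iota j r.+1 = u ++ [:: r] by rewrite index_iota_recr // catA.
have mu1 : mu_ m [:: r] = m r by rewrite /mu_ big_seq1.
rewrite [in RHS](eq_cv _ _ (sum_law_cat u [:: r]) (fun=> erefl)) mu_cat -cvA mu1.
(* [F_nneg r] starts at 0 and [F_neg r] at [m r], which may have either sign; [b] is a common lower
   bound. *)
pose b := Num.min (m r) 0.
have b0 : b <= 0 by rewrite /b; lia.
have bm : b <= m r by rewrite /b; lia.
rewrite -(cv_widenr _ _ b0 (fun k => @F_nneg_lt r k)).
rewrite (eq_cv _ _ (fun=> erefl) (F_nnegE r1)) cvDr cvNr.
rewrite (cv_widenr _ _ bm (fun k => @F_neg_lt r k r1)); congr (_ - _).
rewrite (cv_widenr _ _ bm); last by move=> k kr; rewrite cv_lt ?addr0.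
rewrite addr0; apply: eq_cv => // k; apply: eq_cv => // l.
by rewrite sum_law1.
Qed.

(** * The renewal equation around one period and its solution *)

Let D := mu_ m (index_iota 1 N.+1).

(** Going around from [j] meets the block [j, ..., N] before the block starting at 1, whereas [I_]
    lists them in the opposite order. *)
Lemma sum_law_perm s1 s2 : sum_law (s1 ++ s2) =1 sum_law (s2 ++ s1).
Proof. by move=> k; rewrite !sum_law_cat cvC. Qed.

Lemma mu_perm s1 s2 : mu_ m (s1 ++ s2) = mu_ m (s2 ++ s1).
Proof. by rewrite !mu_cat addrC. Qed.

(** Telescoping runs from [j] to [N.+1], which periodicity identifies with 1, and then from 1 to [j]
    with prefix [j, ..., N]. The second stage gives the terms [t < j], the first those with
    [t >= j]. *)
Lemma F_nneg_renewal j n : (1 <= j <= N)%N ->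
  F_nneg j n = cv D 0 (sum_law (index_iota 1 N.+1)) (F_nneg j) n -
  \sum_(1 <= t < N.+1)
    cv (mu_ m (I_ N j t)) (m t) (sum_law (I_ N j t)) (F_neg t) n.
Proof.
case/andP=> j1 jN.
have iotaE : index_iota 1 N.+1 = index_iota 1 j ++ index_iota j N.+1.
  rewrite /index_iota -[in LHS](_ : (j - 1 + (N.+1 - j))%N = (N.+1 - 1)%N); last by lia.
  by rewrite iotaD subnKC.
have FN1 : F_nneg N.+1 =1 F_nneg 1.
  by move=> k; rewrite /F_nneg -add1n F_infty_periodic.
have E0 : F_nneg j n = cv (mu_ m [::]) 0 (sum_law [::]) (F_nneg j) n.
  by rewrite /mu_ big_nil cv_delta // => k; exact: F_nneg_lt.
rewrite {}[LHS]E0 (@cv_sum_law_telescope _ _ N.+1); last by lia.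
rewrite cat0s (eq_cv _ _ (fun=> erefl) FN1).
rewrite (@cv_sum_law_telescope _ 1 j); last by lia.
rewrite (eq_cv _ _ (sum_law_perm _ _) (fun=> erefl)) -iotaE.
rewrite [mu_ m (index_iota j _ ++ index_iota 1 j)]mu_perm -iotaE -/D.
rewrite [in RHS](big_cat_nat (n := j)) //=; last by lia.
rewrite opprD addrA; congr (_ - _ - _).
  apply: eq_big_nat => t /andP[t1 tj]; rewrite /I_ ltnNge ltnW //=.
  rewrite (_ : j == t = false); last by lia.
  rewrite (eq_cv _ _ (sum_law_perm _ _) (fun=> erefl)).
  by rewrite mu_perm.
apply: eq_big_nat => t /andP[jt tN]; rewrite /I_.
case: ifP => // jt'; have -> : j = t by lia.
by rewrite eqxx /index_iota subnn.
Qed.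

Lemma F_infty_expansion j (n : nat) : (1 <= j <= N)%N -> D < 0 ->
  (forall t, (1 <= t <= N)%N -> 0 < step_law t (m t)) ->
  F_infty X j n%:Z = \sum_(1 <= r < N.+1)
    sumz (m r) (-1) (fun l =>
      aI_ D (sum_law (index_iota 1 N.+1)) (mu_ m (I_ N j r)) (sum_law (I_ N j r))
        (n%:Z - l) * F_infty X r l).
Proof.
move=> jN D0 law_gt0; set f := sum_law (index_iota 1 N.+1); set a := a_ D f.
have fD : f D != 0.
  rewrite gt_eqF // /f /D; apply: sum_law_mu_gt0 => t.
  by rewrite mem_index_iota => tN; apply: law_gt0; lia.
pose K t := cv (mu_ m (I_ N j t)) (m t) (sum_law (I_ N j t)) (F_neg t).
have Gj0 k : k < 0 -> F_nneg j k = 0 by exact: F_nneg_lt.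
have a0 k : k < - D -> a k = 0 by exact: a_eq0.
have renewal : cv D 0 f (F_nneg j) =1
    (fun k => F_nneg j k + \sum_(1 <= t < N.+1) K t k).
  by move=> k; rewrite [F_nneg j k in RHS]F_nneg_renewal // subrK.
(* A common lower bound for [F_nneg j], its convolution with [f], and all the series [K t]. *)
have [b bD bK] : exists2 b : int, b <= D &
    forall t, (1 <= t <= N)%N -> b <= mu_ m (I_ N j t) + m t.
  exact: finite_lower_bound.
have : F_nneg j n = cv (- D) b a (fun k => \sum_(1 <= t < N.+1) K t k) n.
  (* The product of [a], [f] and [F_nneg j] is computed in two ways: here by the renewal equation
     for [f] times [F_nneg j]. *)
  have : cv 0 0 (cv D (- D) f a) (F_nneg j) n =
      cv (- D) b a (F_nneg j) n +
      cv (- D) b a (fun k => \sum_(1 <= t < N.+1) K t k) n.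
    rewrite -cvDr -(eq_cv _ _ (fun=> erefl) renewal).
    rewrite (cv_widenr _ _ bD); last by move=> k kD; rewrite cv_lt ?addr0.
    have := cvA (- D) D 0 a f (F_nneg j) n; rewrite addr0 addNr => ->.
    by apply: eq_cv => // k; rewrite cvC.
  (* And here by [cv_a], which replaces [f] times [a] by [a] plus the unit. Once the lower bounds
     agree, [a] times [F_nneg j] cancels. *)
  rewrite (eq_cv _ _ (fun k => cv_a k D0 fD) (fun=> erefl)) cvC cvDr.
  rewrite -/a (cvC _ _ _ (fun k => (k == 0)%:R)) cv_delta //.
  have b0 : b <= 0 by lia.
  have D00 : 0 <= - D by lia.
  rewrite (cv_widenr _ _ b0 Gj0) (cv_widenr _ _ D00 a0) cvC.
  exact: addrI.
rewrite {1}/F_nneg /= => ->.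
have cv_sum (Q : nat -> int -> R) M k :
    cv (- D) b a (fun k => \sum_(1 <= t < M.+1) Q t k) k =
    \sum_(1 <= t < M.+1) cv (- D) b a (Q t) k.
  elim: M k => [|M IH] k.
    rewrite big_geq // -[RHS](cv0r (- D) b a k).
    by apply: eq_cv => // l; rewrite big_geq.
  rewrite big_nat_recr //= -IH -cvDr; apply: eq_cv => // l.
  by rewrite big_nat_recr.
rewrite cv_sum; apply: eq_big_nat => t tN.
have t1 : (1 <= t)%N by case/andP: tN.
rewrite (cv_widenr _ _ (bK t _)); [|lia|by move=> k kt; rewrite /K cv_lt].
rewrite /K cvA cvC /cv; set mI := mu_ m _.
pose F l := F_neg t l * aI_ D f mI (sum_law (I_ N j t)) (n%:Z - l).
transitivity (sumz (m t) (n%:Z - (- D + mI)) F).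
  by apply: eq_sumz => l _; rewrite /F aI_cv -/(cv _ _ _ _ _) cvC.
(* The two upper limits [n + D - mI] and [-1] are not ordered, so both sums are compared with the
   one up to [c]: [aI_] vanishes beyond the first limit, [F_neg] beyond the second. *)
pose c := n%:Z + `|D| + `|mI| + 1.
rewrite -(@sumz_narrow _ _ _ c); first last.
- move=> k _ ck; rewrite /F aI_cv cv_lt ?mulr0 //; lia.
- by rewrite /c; lia.
rewrite (@sumz_narrow _ _ (-1) c); first last.
- by move=> k _ ck; rewrite /F /F_neg ifF ?mul0r //; lia.
- by rewrite /c; lia.
by apply: eq_sumz => l lm; rewrite /F mulrC /F_neg ifT //; lia.
Qed.

End Walk.

Theorem theorem1 (d : measure_display) (T : measurableType d) (R : realType)
    (P : probability T R) (N : nat) (X : nat -> {RV P >-> R}) (m : nat -> int)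
    (N_gt0 : (0 < N)%N)
    (X_int : forall k : nat, (1 <= k)%N -> forall w : T, X k w \is a Num.int)
    (X_indep : mutually_independent [set k : nat | (1 <= k)%N] X)
    (X_periodic : forall k : nat, (1 <= k)%N ->
      forall A : set R, measurable A ->
        distribution P (X k) A = distribution P (X (k + N)%N) A)
    (X_start : forall j : nat, (1 <= j <= N)%N ->
      (0 < P [set w | X j w = (m j)%:~R])%E /\
      P [set w | (m j)%:~R <= X j w] = 1%E)
    (D_lt0 : \sum_(1 <= j < N.+1) m j < 0)
    (ES_lt0 : ('E_P[rv_sum X (index_iota 1 N.+1)] < 0)%E) :
  let D : int := \sum_(1 <= j < N.+1) m j in
  let fN : int -> R := psum X (index_iota 1 N.+1) in
  let a (I : seq nat) : int -> R := aI_ D fN (mu_ m I) (psum X I) in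
  forall j : nat, (1 <= j <= N)%N -> forall n : nat,
    F_infty X j n%:Z =
    \sum_(1 <= r < N.+1)
      sumz (m r) (-1) (fun l : int =>
        a (I_ N j r) (n%:Z - l) *
        \sum_(0 <= i < (absz (l - m r)%R).+1)
          pi_ X (next_index N r) i * fine (cdf (X r) (l - i%:Z)%:~R)).

Proof.
move=> D fN a j jN n.
(* [m'] extends [m] periodically beyond the indices 1, ..., N. *)
pose m' t := m (t.-1 %% N).+1.
have m'E t : (1 <= t <= N)%N -> m' t = m t.
  by case: t => [|t] tN //; rewrite /m' modn_small //; lia.
have X_start' t : (1 <= t)%N -> P [set w | X t w < (m' t)%:~R] = 0%E.
  move=> t1.
  have shift q s (c : R) : (1 <= s)%N ->
      P [set w | X (s + q * N)%N w < c] = P [set w | X s w < c].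
    move=> s1; elim: q => [|q IH]; first by rewrite mul0n addn0.
    rewrite -IH mulSnr addnA; have s'1 : (1 <= s + q * N)%N by lia.
    by have /esym := X_periodic _ s'1 _ (measurable_itv `]-oo, c[); rewrite set_itvNyo.
  (* Division of [t.-1] rather than [t] gives representatives in 1, ..., [N]. *)
  have tE : t = ((t.-1 %% N).+1 + (t.-1 %/ N) * N)%N.
    by have := divn_eq t.-1 N; lia.
  rewrite [in X t]tE shift // /m'; set s := (_ %% N).+1.
  have sN : (1 <= s <= N)%N by rewrite /s /= ltn_mod.
  have [_ ge1] := X_start s sN.
  have mge : measurable [set w | (m s)%:~R <= X s w].
    by have := measurable_funPTI (X s) (measurable_itv `[(m s)%:~R, +oo[); rewrite set_itvcy.
  rewrite (_ : [set w | _] = ~` [set w | (m s)%:~R <= X s w]).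
    by rewrite probability_setC // ge1 subee.
  by apply/seteqP; split=> w /=; rewrite ltNge => /negP.
have m'_periodic t : (1 <= t)%N -> m' (t + N)%N = m' t.
  by case: t => // t _; rewrite /m' addSn /= modnDr.
have law_periodic t : (1 <= t)%N -> step_law X (t + N)%N =1 step_law X t.
  move=> t1 k; rewrite /step_law /pr; congr fine; apply/esym.
  exact: (X_periodic t t1 [set k%:~R] (measurable_set1 _)).
have muE s : (forall t, t \in s -> (1 <= t <= N)%N) -> mu_ m s = mu_ m' s.
  by move=> sN; apply: eq_big_seq => t /sN tN; rewrite m'E.
have DE : D = mu_ m' (index_iota 1 N.+1).
  by apply: muE => t; rewrite mem_index_iota; lia.
have IN r : (1 <= r <= N)%N ->
    uniq (I_ N j r) /\ forall t, t \in I_ N j r -> (1 <= t <= N)%N.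
  move=> rN; rewrite /I_; case: ifP => jr.
    by split=> [|t]; [exact: iota_uniq|rewrite mem_index_iota; lia].
  case: eqP => // jr'; split=> [|t].
    rewrite cat_uniq !iota_uniq andbT; apply/hasPn => t.
    by rewrite !mem_index_iota; lia.
  by rewrite mem_cat !mem_index_iota; lia.
have fNE : fN = sum_law X m' (index_iota 1 N.+1).
  apply/funext => k; apply: psumE => //; first exact: iota_uniq.
  by apply/allP => t; rewrite mem_index_iota; lia.
rewrite (F_infty_expansion (m := m') X_int X_indep X_start' N_gt0) -?DE //; last first.
  move=> t tN; rewrite m'E //; have [+ _] := X_start t tN.
  by rewrite -lte_fin /step_law prE //; exact: measurable_preimage_eq.
apply: eq_big_nat => r rN; rewrite m'E //; apply: eq_sumz => l lr.
have [uI Ir] := IN r rN.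
have r1 : (1 <= r)%N by case/andP: rN.
rewrite /a fNE (muE _ Ir) (_ : psum X (I_ N j r) = sum_law X m' (I_ N j r)); last first.
  apply/funext => k; apply: psumE => //.
  by apply/allP => t /Ir /andP[].
congr (_ * _).
have next1 : (1 <= next_index N r)%N by rewrite /next_index; case: ifP.
(* For [r = N] this identifies the index 1 with [N.+1], as [sum_pi_cdf] requires of [r']. *)
have nextE x : F_infty X (next_index N r) x = F_infty X r.+1 x.
  rewrite /next_index; case: eqP => // ->.
  by rewrite -[N.+1]add1n (F_infty_periodic X_int X_indep X_start').
rewrite -(m'E _ rN) (sum_pi_cdf X_int X_indep X_start') ?m'E //; lia.
Qed.
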